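(* Let $X$ be a rack and $A$ an associative algebra. The graded module $\{C^n(N(X),A)\}_{n\in\mathbb{N}}$ provided with the products defined, for $f_1\in C^{p_1}(N(X),A)$ and $f_2\in C^{p_2}(N(X),A)$, by $$f_1\succ f_2=\sum_{\sigma\in\mathrm{Sh}_{p_1,p_2}^{p_1+p_2}}\epsilon(\sigma)\,\mu_A\circ(f_1\times f_2)\circ\rho_\sigma,\qquad f_1\prec f_2=\sum_{\sigma\in\mathrm{Sh}_{p_1,p_2}^{p_1}}\epsilon(\sigma)\,\mu_A\circ(f_1\times f_2)\circ\rho_\sigma$$ is a graded dendriform algebra.
   Context: A rack is a set $X$ with a binary operation $\rhd$ such that $x\rhd(y\rhd z)=(x\rhd y)\rhd(x\rhd z)$ and each map $y\mapsto x\rhd y$ is bijective. $A$ is an associative algebra over a commutative ring, with product $\mu_A:A\times A\to A$. $\mathbb{N}=\{0,1,2,\dots\}$. Trunks. For a directed graph with edge set $E$, source $s$ and target $t$, let $\mathrm{S}$ be the set of quadruples $(a,b,c,d)$ of edges with $s(a)=s(c)$, $t(a)=s(b)$, $t(c)=s(d)$, $t(b)=t(d)$. A trunk is a directed graph with a subset $\Gamma\subseteq\mathrm{S}$ of ''preferred squares''. A trunk map is a graph map sending preferred squares to preferred squares. The cube $\square_n$ is the trunk whose vertices are the subsets of $\{1,\dots,n\}$, whose edges are the pairs $A\to A\amalg\{k\}$ with $k\notin A$, and whose preferred squares are $$\big(A\to A\amalg\{k\},\ A\amalg\{k\}\to A\amalg\{k,l\},\ A\to A\amalg\{l\},\ A\amalg\{l\}\to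 A\amalg\{k,l\}\big),\quad k<l,\ k,l\notin A.$$ The trunk of the rack $X$, also denoted $X$, has one vertex, edge set $X$, and preferred squares $(a,b,a\rhd b,a)$ for $a,b\in X$. The nerve: $N(X)(\square_n)$ is the set of trunk maps $\square_n\to X$. $C^n(N(X),A)$ is the set of all maps $N(X)(\square_n)\to A$. Shuffles. $\mathrm{Sh}_{p_1,p_2}$ is the set of permutations $\sigma$ of $\{1,\dots,p_1+p_2\}$ with $\sigma(1)<\dots<\sigma(p_1)$ and $\sigma(p_1+1)<\dots<\sigma(p_1+p_2)$; $\epsilon$ is the sign. For $p_1,p_2\ge1$, $\mathrm{Sh}_{p_1,p_2}^{p_1}$ is the subset with $\sigma(p_1)=p_1+p_2$ and $\mathrm{Sh}_{p_1,p_2}^{p_1+p_2}$ the subset with $\sigma(p_1+p_2)=p_1+p_2$. Conventions when an index is $0$: if $p_1=0$ then $\mathrm{Sh}_{0,p_2}^{p_1+p_2}=\{\mathrm{id}\}$ and $\mathrm{Sh}_{0,p_2}^{p_1}=\emptyset$ (including $p_2=0$); if $p_1\ge1$, $p_2=0$ then $\mathrm{Sh}_{p_1,0}^{p_1}=\{\mathrm{id}\}$ and $\mathrm{Sh}_{p_1,0}^{p_1+p_2}=\emptyset$. For $\sigma\in\mathrm{Sh}_{p_1,p_2}$ the trunk maps $\sigma\circ i_{p_1}:\square_{p_1}\to\square_{p_1+p_2}$ and $\sigma\circ i_{p_2}:\square_{p_2}\to\square_{p_1+p_2}$ are given on vertices by $(\sigma\circ i_{p_1})(A)=\{\sigma(a):a\in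 A\}$ and $(\sigma\circ i_{p_2})(A)=\{\sigma(1),\dots,\sigma(p_1)\}\cup\{\sigma(p_1+a):a\in A\}$. The map $\rho_\sigma:N(X)(\square_{p_1+p_2})\to N(X)(\square_{p_1})\times N(X)(\square_{p_2})$ is $\rho_\sigma(F)=(F\circ\sigma\circ i_{p_1},\,F\circ\sigma\circ i_{p_2})$. A graded dendriform algebra is a graded module $D$ with two degree-preserving linear maps $\succ,\prec:D\otimes D\to D$ satisfying for all $x,y,z$: $x\succ(y\succ z)=(x\succ y)\succ z+(x\prec y)\succ z$; $(x\succ y)\prec z=x\succ(y\prec z)$; $(x\prec y)\prec z=x\prec(y\prec z)+x\prec(y\succ z)$. *)

(* Defs.v *)
From HB Require Import structures.
From mathcomp Require Import all_boot all_fingroup all_algebra.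
From mathcomp Require Import boolp functions.
Set Implicit Arguments.
Unset Strict Implicit.
Unset Printing Implicit Defensive.
Import GRing.Theory.
Local Open Scope ring_scope.

Record rack : Type := Rack {
  rack_carrier :> Type;
  rack_op : rack_carrier -> rack_carrier -> rack_carrier;
  rack_distr : forall x y z,
    rack_op x (rack_op y z) = rack_op (rack_op x y) (rack_op x z);
  rack_bij : forall x, bijective (rack_op x)
}.

(* Squares are given by their edges (a, b, c, d): the two paths from the
   initial to the final vertex are a followed by b, and c followed by d. *)
Definition is_square (V E : Type) (s t : E -> V) (a b c d : E) : Prop :=
  [/\ s a = s c, t a = s b, t c = s d & t b = t d].

Record trunk : Type := Trunk {
  vertex : Type;
  edge : Type;
  source : edge -> vertex;
  target : edge -> vertex;
  preferred : edge -> edge -> edge -> edge -> Prop;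
  preferred_square : forall a b c d,
    preferred a b c d -> is_square source target a b c d
}.
Arguments source {t} _.
Arguments target {t} _.
Arguments preferred {t} _ _ _ _.

Record trunk_map (T U : trunk) : Type := TrunkMap {
  vmap : vertex T -> vertex U;
  emap : edge T -> edge U;
  trunk_map_source : forall e, source (emap e) = vmap (source e);
  trunk_map_target : forall e, target (emap e) = vmap (target e);
  trunk_map_preferred : forall a b c d, preferred a b c d ->
    preferred (emap a) (emap b) (emap c) (emap d)
}.

Definition trunk_comp (T U W : trunk) (G : trunk_map U W) (F : trunk_map T U) :
  trunk_map T W.
Proof.
refine (@TrunkMap T W (vmap G \o vmap F) (emap G \o emap F) _ _ _).
- by move=> e /=; rewrite !trunk_map_source.
- by move=> e /=; rewrite !trunk_map_target.
- by move=> a b c d Pabcd; do 2!apply: trunk_map_preferred.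
Defined.

(* The index set {1, ..., n} is represented by 'I_n = {0, ..., n - 1}. *)

(* The edge A -> A + {k}, with k not in A. *)
Record cube_edge (n : nat) : Type := CubeEdge {
  edge_src : {set 'I_n};
  edge_dir : 'I_n;
  edge_dir_notin : edge_dir \notin edge_src
}.

Definition edge_tgt (n : nat) (e : cube_edge n) : {set 'I_n} :=
  edge_dir e |: edge_src e.

Definition is_edge (n : nat) (e : cube_edge n) (A : {set 'I_n}) (k : 'I_n) :
  Prop := edge_src e = A /\ edge_dir e = k.

Definition cube_preferred (n : nat) (a b c d : cube_edge n) : Prop :=
  exists (A : {set 'I_n}) (k l : 'I_n),
    [/\ (k < l)%N, k \notin A & l \notin A] /\
    [/\ is_edge a A k, is_edge b (k |: A) l,
        is_edge c A l & is_edge d (l |: A) k].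

Lemma cube_preferred_square (n : nat) (a b c d : cube_edge n) :
  cube_preferred a b c d ->
  is_square (@edge_src n) (@edge_tgt n) a b c d.
Proof.
case=> A [k [l [_ [[a1 a2] [b1 b2] [c1 c2] [d1 d2]]]]].
by rewrite /is_square /edge_tgt a1 a2 b1 b2 c1 c2 d1 d2 setUCA.
Qed.

Definition cube (n : nat) : trunk := Trunk (@cube_preferred_square n).

Definition rack_preferred (X : rack) (a b c d : X) : Prop :=
  c = rack_op a b /\ d = a.

Lemma rack_preferred_square (X : rack) (a b c d : X) :
  rack_preferred a b c d ->
  is_square (fun _ : X => tt) (fun _ : X => tt) a b c d.
Proof. by []. Qed.

Definition rack_trunk (X : rack) : trunk := Trunk (@rack_preferred_square X).

Definition nerve (X : rack) (n : nat) : Type :=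
  trunk_map (cube n) (rack_trunk X).

Definition is_shuffle (p1 p2 : nat) (s : 'S_(p1 + p2)) : bool :=
  [forall i : 'I_p1, forall j : 'I_p1,
     (i < j)%N ==> (s (lshift p2 i) < s (lshift p2 j))%N] &&
  [forall i : 'I_p2, forall j : 'I_p2,
     (i < j)%N ==> (s (rshift p1 i) < s (rshift p1 j))%N].

Definition shuffle (p1 p2 : nat) : Type :=
  {s : 'S_(p1 + p2) | is_shuffle s}.

HB.instance Definition _ (p1 p2 : nat) := SubFinite.on (shuffle p1 p2).

Lemma is_shuffle1 (p1 p2 : nat) : is_shuffle (1%g : 'S_(p1 + p2)).
Proof.
apply/andP; split; apply/'forall_forallP => i j; apply/implyP => ij.
  by rewrite !perm1.
by rewrite !perm1 /= ltn_add2l.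
Qed.

Definition id_shuffle (p1 p2 : nat) : shuffle p1 p2 :=
  exist _ (1%g : 'S_(p1 + p2)) (is_shuffle1 p1 p2).

(* Superscript p1: the last element of the first block is sent to the top. *)
Definition Sh_fst (p1 p2 : nat) : {set shuffle p1 p2} :=
  match p1, p2 return {set shuffle p1 p2} with
  | 0, p2 => set0
  | p1.+1, 0 => [set id_shuffle p1.+1 0]
  | p1.+1, p2.+1 =>
      [set s : shuffle p1.+1 p2.+1 |
         val s (lshift p2.+1 (@ord_max p1)) == ord_max]
  end.

(* Superscript p1 + p2: the last element of the second block is sent to the
   top. *)
Definition Sh_snd (p1 p2 : nat) : {set shuffle p1 p2} :=
  match p1, p2 return {set shuffle p1 p2} with
  | 0, p2 => [set id_shuffle 0 p2]
  | p1.+1, 0 => set0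
  | p1.+1, p2.+1 =>
      [set s : shuffle p1.+1 p2.+1 |
         val s (rshift p1.+1 (@ord_max p2)) == ord_max]
  end.

(* A map v on the vertices of a cube determines the map on the edges, since an
   edge is determined by its endpoints; h is the effect on directions. *)
Definition cube_map (m n : nat) (v : {set 'I_m} -> {set 'I_n})
    (h : 'I_m -> 'I_n)
    (h_incr : forall i j : 'I_m, (i < j)%N -> (h i < h j)%N)
    (v_add : forall A k, v (k |: A) = h k |: v A)
    (v_notin : forall (A : {set 'I_m}) k, k \notin A -> h k \notin v A) :
  trunk_map (cube m) (cube n).
Proof.
refine (@TrunkMap (cube m) (cube n) v
  (fun e : cube_edge m => CubeEdge (v_notin _ _ (edge_dir_notin e))) _ _ _).
- by [].
- by move=> e /=; rewrite /edge_tgt v_add.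
- move=> a b c d [A [k [l [[kl kA lA]]]]].
  case=> [[a1 a2] [b1 b2] [c1 c2] [d1 d2]].
  exists (v A), (h k), (h l); split; first by split; auto.
  by rewrite /is_edge /= a1 a2 b1 b2 c1 c2 d1 d2 !v_add.
Defined.

Section ShuffleFaces.
Context (p1 p2 : nat) (s : shuffle p1 p2).

Definition face1_vertex (A : {set 'I_p1}) : {set 'I_(p1 + p2)} :=
  [set val s (lshift p2 a) | a in A].

Definition face2_vertex (A : {set 'I_p2}) : {set 'I_(p1 + p2)} :=
  [set val s (lshift p2 a) | a : 'I_p1] :|:
  [set val s (rshift p1 a) | a in A].

Lemma face1_incr (i j : 'I_p1) :
  (i < j)%N -> (val s (lshift p2 i) < val s (lshift p2 j))%N.
Proof. by case/andP: (valP s) => /'forall_forallP/(_ i j)/implyP. Qed.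

Lemma face2_incr (i j : 'I_p2) :
  (i < j)%N -> (val s (rshift p1 i) < val s (rshift p1 j))%N.
Proof. by case/andP: (valP s) => _ /'forall_forallP/(_ i j)/implyP. Qed.

Lemma face1_add (A : {set 'I_p1}) k :
  face1_vertex (k |: A) = val s (lshift p2 k) |: face1_vertex A.
Proof. by rewrite /face1_vertex imsetU1. Qed.

Lemma face2_add (A : {set 'I_p2}) k :
  face2_vertex (k |: A) = val s (rshift p1 k) |: face2_vertex A.
Proof. by rewrite /face2_vertex imsetU1 setUCA. Qed.

Lemma face1_notin (A : {set 'I_p1}) k :
  k \notin A -> val s (lshift p2 k) \notin face1_vertex A.
Proof.
by apply: contra => /imsetP[a aA /perm_inj/lshift_inj->].
Qed.

Lemma face2_notin (A : {set 'I_p2}) k :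
  k \notin A -> val s (rshift p1 k) \notin face2_vertex A.
Proof.
apply: contra; rewrite inE => /orP[] /imsetP[a aA /perm_inj].
  by move/eqP; rewrite eq_rlshift.
by move/rshift_inj->.
Qed.

Definition face1 : trunk_map (cube p1) (cube (p1 + p2)) :=
  cube_map face1_incr face1_add face1_notin.

Definition face2 : trunk_map (cube p2) (cube (p1 + p2)) :=
  cube_map face2_incr face2_add face2_notin.

Definition rho (X : rack) (F : nerve X (p1 + p2)) : nerve X p1 * nerve X p2 :=
  (trunk_comp F face1, trunk_comp F face2).

End ShuffleFaces.

(* The library's bilinear maps require a nontrivial ring of scalars. *)
Definition is_bilinear (k : comPzRingType) (U V W : lmodType k)
    (f : U -> V -> W) : Prop :=
  (forall x, linear (f x)) /\ (forall y, linear (fun x => f x y)).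

Definition cochain (k : comPzRingType) (X : rack) (A : lmodType k) (n : nat) :
  lmodType k := (nerve X n -> A).

Definition cochain_succ (k : comPzRingType) (X : rack) (A : lmodType k)
    (mu : A -> A -> A) (p1 p2 : nat)
    (f1 : cochain X A p1) (f2 : cochain X A p2) : cochain X A (p1 + p2) :=
  \sum_(s in Sh_snd p1 p2)
    (-1) ^+ (val s : 'S_(p1 + p2)) *:
    ((fun F => mu (f1 (rho s F).1) (f2 (rho s F).2)) : cochain X A (p1 + p2)).

Definition cochain_prec (k : comPzRingType) (X : rack) (A : lmodType k)
    (mu : A -> A -> A) (p1 p2 : nat)
    (f1 : cochain X A p1) (f2 : cochain X A p2) : cochain X A (p1 + p2) :=
  \sum_(s in Sh_fst p1 p2)
    (-1) ^+ (val s : 'S_(p1 + p2)) *: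
    ((fun F => mu (f1 (rho s F).1) (f2 (rho s F).2)) : cochain X A (p1 + p2)).

(* Transport of homogeneous elements along an equality of degrees. *)
Definition deg_cast (k : comPzRingType) (D : nat -> lmodType k) (m n : nat)
  (e : m = n) (x : D m) : D n := ecast i (D i) e x.

(* A graded module is the family of its homogeneous components; a
   degree-preserving linear map D (x) D -> D is a family of bilinear maps
   D p -> D q -> D (p + q), and by linearity the axioms range over homogeneous
   elements. *)
Record is_graded_dendriform (k : comPzRingType) (D : nat -> lmodType k)
    (succ prec : forall p q : nat, D p -> D q -> D (p + q)%N) : Prop :=
  IsGradedDendriform {
  dend_succ_bilinear : forall p q, is_bilinear (@succ p q);
  dend_prec_bilinear : forall p q, is_bilinear (@prec p q);
  dend_succ_succ : forall p q r (x : D p) (y : D q) (z : D r),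
    deg_cast (addnA p q r) (succ _ _ x (succ _ _ y z)) =
    succ _ _ (succ _ _ x y) z + succ _ _ (prec _ _ x y) z;
  dend_succ_prec : forall p q r (x : D p) (y : D q) (z : D r),
    prec _ _ (succ _ _ x y) z =
    deg_cast (addnA p q r) (succ _ _ x (prec _ _ y z));
  dend_prec_prec : forall p q r (x : D p) (y : D q) (z : D r),
    prec _ _ (prec _ _ x y) z =
    deg_cast (addnA p q r)
      (prec _ _ x (prec _ _ y z) + prec _ _ x (succ _ _ y z))
}.

(* Main.v *)
Require Import Defs.
From HB Require Import structures.
From mathcomp Require Import all_boot all_algebra.
From mathcomp Require Import all_fingroup boolp functions.
Set Implicit Arguments.
Unset Strict Implicit.
Unset Printing Implicit Defensive.
Import GRing.Theory.
Local Open Scope ring_scope.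

(** The three dendriform identities are one identity read off at the three
possible positions of the largest value.

Call a triple shuffle a permutation of [p + q + r] letters that is increasing
on the consecutive blocks of sizes [p], [q], [r].  Shuffling the first two
blocks and then the result with the third one ([joinl]), or the last two blocks
and then the first one with the result ([joinr]), gives two bijections from
pairs of binary shuffles onto triple shuffles.  Injectivity and surjectivity
both rest on standardization: an injective sequence has the relative order of
exactly one permutation, and this recovers the inner shuffle from the triple
one.  Both bijections multiply signs, because an inner shuffle acts as a block
sum with an identity, and both are compatible with the decomposition of the
cube into consecutive subcubes.  By bilinearity and associativity of the
product, every iterated product of cochains [f], [g], [h] is therefore a signed
sum over a set of triple shuffles ([shuffle_prodl], [shuffle_prodr]), and only
these sets remain to be compared.

The superscript [p1] in the definition of the products says that the first
block reaches the top value, and the superscript [p1 + p2] is the complementary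
condition; in this form the description holds for empty blocks as well
([in_Sh_fst], [in_Sh_snd]).  Consequently both sides of the first, second and
third identity are the sums over the triple shuffles in which the top value is
reached by the third, second and first block respectively, where for the third
block this means by neither of the other two. *)

(** * Increasing maps and standardization *)

(** Strictly increasing maps, with the quantifiers over indices in boolean form,
so that [is_shuffle] unfolds to a conjunction of two instances. *)
Definition increasing (m n : nat) (f : 'I_m -> 'I_n) : bool :=
  [forall i : 'I_m, forall j : 'I_m, (i < j)%N ==> (f i < f j)%N].

Lemma increasingP (m n : nat) (f : 'I_m -> 'I_n) :
  reflect {homo f : i j / (i < j)%N} (increasing f).
Proof.
apply: (iffP 'forall_forallP) => [H i j|H i j]; first exact/implyP/H.
exact/implyP/H.
Qed.

Lemma increasing_ltn (m n : nat) (f : 'I_m -> 'I_n) :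
  increasing f -> {mono f : i j / (i < j)%N}.
Proof.
move/increasingP=> incf i j.
case: (ltngtP i j) => [/incf->//|/incf|/val_inj->]; last by rewrite ltnn.
by move=> ji; apply/negbTE; rewrite -leqNgt ltnW.
Qed.

Lemma increasing_inj (m n : nat) (f : 'I_m -> 'I_n) :
  increasing f -> injective f.
Proof.
move=> incf i j fij; apply/val_inj.
by case: (ltngtP i j) => //; rewrite -(increasing_ltn incf) fij ltnn.
Qed.

(** A permutation is determined by the order of its values: the value at [i] is
the number of values that are smaller. *)
Lemma perm_rank (n : nat) (t : 'S_n) (i : 'I_n) :
  t i = #|[set j | (t j < t i)%N]| :> nat.
Proof.
rewrite -(card_imset _ (@perm_inj _ t)).
have -> : t @: [set j | (t j < t i)%N] = [set k : 'I_n | (k < t i)%N].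
  apply/setP => k; rewrite inE; apply/imsetP/idP => [[j]|kti].
    by rewrite inE => + ->.
  by exists (t^-1 k)%g; rewrite ?inE permKV.
have le_ti : (t i <= n)%N by apply: ltnW.
have -> : [set k : 'I_n | (k < t i)%N] = [set widen_ord le_ti j | j : 'I_(t i)].
  apply/setP => k; rewrite inE; apply/idP/imsetP => [kti|[j _ ->]];
    last by rewrite /= ltn_ord.
  by exists (Ordinal kti); last exact/val_inj.
by rewrite card_imset ?card_ord // => j j' /(congr1 val)/= /val_inj.
Qed.

Lemma eq_perm_order (n : nat) (s t : 'S_n) :
  (forall i j, (s i < s j)%N = (t i < t j)%N) -> s = t.
Proof.
move=> st; apply/permP => i; apply/val_inj.
rewrite /= [LHS]perm_rank [RHS]perm_rank.
by apply: eq_card => j; rewrite !inE st.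
Qed.

(** Every injective finite sequence has the same relative order as a
permutation, its standardization. *)
Lemma standardization (m n : nat) (f : 'I_m -> 'I_n) : injective f ->
  exists t : 'S_m, forall i j, (t i < t j)%N = (f i < f j)%N.
Proof.
move=> injf.
have rk_lt i : (#|[set j | (f j < f i)%N]| < m)%N.
  rewrite -[X in (_ < X)%N]card_ord -cardsT; apply: proper_card.
  by apply/properP; split; [apply: subsetT | exists i; rewrite // inE ltnn].
pose rk i := Ordinal (rk_lt i).
have rk_mono i j : (f i < f j)%N -> (rk i < rk j)%N.
  move=> ij; apply: proper_card; apply/properP; split; last first.
    by exists i; rewrite !inE ?ltnn.
  by apply/subsetP => h; rewrite !inE => /ltn_trans->.
have rk_inj : injective rk.
  move=> i j rkij; apply/injf/val_inj.
  by case: (ltngtP (f i) (f j)) => // /rk_mono; rewrite rkij ltnn.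
exists (perm rk_inj) => i j; rewrite !permE.
case: (ltngtP (f i) (f j)) => [/rk_mono->//|/rk_mono|/val_inj/injf->].
  by move=> ji; apply/negbTE; rewrite -leqNgt ltnW.
by rewrite ltnn.
Qed.

(** * Block sums of permutations *)

Section BlockPerm.
Context (m n : nat) (s : 'S_m) (t : 'S_n).

Definition block_perm_fun (i : 'I_(m + n)) : 'I_(m + n) :=
  match fintype.split i with
  | inl j => lshift n (s j)
  | inr j => rshift m (t j)
  end.

Lemma block_perm_inj : injective block_perm_fun.
Proof.
move=> i j; rewrite /block_perm_fun.
case: (split_ordP i) => i' ->; case: (split_ordP j) => j' -> /eqP.
- by rewrite eq_lshift => /eqP/perm_inj->.
- by rewrite eq_lrshift.
- by rewrite eq_rlshift.
- by rewrite eq_rshift => /eqP/perm_inj->.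
Qed.

(** The permutation acting as [s] on the first block and as [t] on the second
block. *)
Definition block_perm : 'S_(m + n) := perm block_perm_inj.

Lemma block_permL (i : 'I_m) : block_perm (lshift n i) = lshift n (s i).
Proof. by rewrite permE /block_perm_fun (unsplitK (inl i)). Qed.

Lemma block_permR (i : 'I_n) : block_perm (rshift m i) = rshift m (t i).
Proof. by rewrite permE /block_perm_fun (unsplitK (inr i)). Qed.

Lemma perm_mx_block :
  perm_mx block_perm = block_mx (perm_mx s) 0 0 (perm_mx t) :> 'M[int]_(m + n).
Proof.
apply/matrixP => i j; rewrite !mxE.
case: (split_ordP i) => i' ->; rewrite ?block_permL ?block_permR;
  case: (split_ordP j) => j' ->;
  rewrite ?col_mxEu ?col_mxEd ?mxE;
  rewrite ?(unsplitK (inl _)) ?(unsplitK (inr _)) ?mxE.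
- by rewrite eq_lshift.
- by rewrite eq_lrshift.
- by rewrite eq_rlshift.
- by rewrite eq_rshift.
Qed.

(** The permutation matrix of a block sum is block diagonal, so signs multiply
like determinants. *)
Lemma odd_block_perm : odd_perm block_perm = odd_perm s (+) odd_perm t.
Proof.
have := det_perm int block_perm.
rewrite perm_mx_block det_ublock !det_perm.
by case: (odd_perm s); case: (odd_perm t); case: (odd_perm block_perm).
Qed.

End BlockPerm.

Lemma odd_cast_perm (m n : nat) (e : m = n) (s : 'S_m) :
  odd_perm (cast_perm e s) = odd_perm s.
Proof. by case: _ / e; rewrite cast_perm_id. Qed.

(** * Which block reaches the top *)

(** [f] takes the largest value of its codomain. *)
Definition reaches_top (m n : nat) (f : 'I_m -> 'I_n) : bool :=
  [exists i, (f i).+1 == n].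

Lemma reaches_topP (m n : nat) (f : 'I_m -> 'I_n) :
  reflect (exists i, (f i).+1 = n) (reaches_top f).
Proof. exact: 'exists_eqP. Qed.

Lemma eq_reaches_top (m n n' : nat) (f : 'I_m -> 'I_n) (g : 'I_m -> 'I_n') :
  n = n' -> (forall i, f i = g i :> nat) -> reaches_top f = reaches_top g.
Proof. by move=> nE fg; apply: eq_existsb => i; rewrite fg nE. Qed.

(** When an increasing map reaches the top, it does so exactly at the last
index. *)
Lemma increasing_top (m n : nat) (f : 'I_m -> 'I_n) (i : 'I_m) :
  increasing f -> reaches_top f -> ((f i).+1 == n) = (i.+1 == m).
Proof.
move=> incf /reaches_topP[j fj]; have fmono := increasing_ltn incf.
have jE : j.+1 = m.
  apply/eqP; rewrite eqn_leq ltn_ord leqNgt; apply/negP => jm.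
  by have := fmono j (Ordinal jm); rewrite /= ltnSn fj leqNgt ltn_ord.
apply/eqP/eqP => [fi|im]; last first.
  by have -> : i = j by apply/val_inj/succn_inj; rewrite [LHS]im.
have fij : f i = f j by apply/val_inj/succn_inj; rewrite [LHS]fi.
apply: etrans jE; congr _.+1.
by case: (ltngtP i j) => //; rewrite -fmono fij ltnn.
Qed.

Lemma reaches_top_comp (l m n : nat) (f : 'I_l -> 'I_m) (g : 'I_m -> 'I_n) :
  increasing g -> reaches_top g -> reaches_top (g \o f) = reaches_top f.
Proof.
by move=> incg topg; apply: eq_existsb => i; rewrite /= increasing_top.
Qed.

Lemma reaches_top_compW (l m n : nat) (f : 'I_l -> 'I_m) (g : 'I_m -> 'I_n) :
  reaches_top (g \o f) -> reaches_top g.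
Proof. by move=> /reaches_topP[i gfi]; apply/reaches_topP; exists (f i). Qed.

Lemma reaches_top_perm (m n : nat) (f : 'I_m -> 'I_n) (t : 'S_m) :
  reaches_top (f \o t) = reaches_top f.
Proof.
apply/idP/idP => [/reaches_top_compW//|/reaches_topP[i fi]].
by apply/reaches_topP; exists (t^-1 i)%g; rewrite /= permKV.
Qed.

Lemma reaches_top_split (m1 m2 n : nat) (f : 'I_(m1 + m2) -> 'I_n) :
  reaches_top f =
  reaches_top (f \o @lshift m1 m2) || reaches_top (f \o @rshift m1 m2).
Proof.
apply/reaches_topP/orP => [[i]|[]/reaches_topP[i fi]].
- case: (split_ordP i) => j -> fj; [left|right]; apply/reaches_topP;
    by exists j.
- by exists (lshift m2 i).
- by exists (rshift m1 i).
Qed.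

(** Disjoint blocks of an injective map cannot both reach the top. *)
Lemma reaches_top_disjoint (m1 m2 n : nat) (f : 'I_(m1 + m2) -> 'I_n) :
  injective f -> reaches_top (f \o @lshift m1 m2) ->
  reaches_top (f \o @rshift m1 m2) = false.
Proof.
move=> injf /reaches_topP[i fi]; apply/negbTE/reaches_topP => -[j fj].
have /eqP : lshift m2 i = rshift m1 j.
  by apply/injf/val_inj/succn_inj; rewrite [LHS]fi [RHS]fj.
by rewrite eq_lrshift.
Qed.

Lemma perm_reaches_top (n : nat) (s : 'S_n) : (0 < n)%N -> reaches_top s.
Proof.
case: n s => // n s _; apply/reaches_topP.
by exists (s^-1 ord_max)%g; rewrite permKV.
Qed.

(** * Binary shuffles *)

Section Shuffle.
Context (p1 p2 : nat).

(** The restrictions of a permutation to its two blocks. *)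
Definition blk1 (s : 'S_(p1 + p2)) : 'I_p1 -> 'I_(p1 + p2) :=
  s \o @lshift p1 p2.
Definition blk2 (s : 'S_(p1 + p2)) : 'I_p2 -> 'I_(p1 + p2) :=
  s \o @rshift p1 p2.

Lemma shuffle_increasing1 (s : shuffle p1 p2) : increasing (blk1 (val s)).
Proof. by case/andP: (valP s). Qed.

Lemma shuffle_increasing2 (s : shuffle p1 p2) : increasing (blk2 (val s)).
Proof. by case/andP: (valP s). Qed.

(** Exactly one block of a permutation reaches the top, unless both blocks are
empty. *)
Lemma blk2_reaches_top (s : 'S_(p1 + p2)) :
  reaches_top (blk2 s) = (0 < p1 + p2)%N && ~~ reaches_top (blk1 s).
Proof.
have disj := reaches_top_disjoint (@perm_inj _ s).
case: posnP => [/eqP|/(perm_reaches_top s)].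
  rewrite addn_eq0 => /andP[_ /eqP p20]; apply/reaches_topP => -[i _].
  by have := ltn_ord i; rewrite [X in (_ < X)%N]p20.
rewrite reaches_top_split -/(blk1 s) -/(blk2 s) => /orP[t1|t2].
  by rewrite t1; apply: disj.
by rewrite t2; apply/esym/negP => /disj; rewrite t2.
Qed.

End Shuffle.

(** A shuffle with an empty block is the identity. *)
Lemma shuffle_perm1 (p1 p2 : nat) (s : shuffle p1 p2) :
  (p1 == 0)%N || (p2 == 0)%N -> s = id_shuffle p1 p2.
Proof.
move=> p0; apply/val_inj/eq_perm_order => i j /=; rewrite !perm1.
have noblk (n : nat) (k : 'I_n) : n != 0%N by case: n k => // -[].
case: (split_ordP i) => i' ->; case: (split_ordP j) => j' ->.
- exact: increasing_ltn (shuffle_increasing1 s) _ _.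
- by move: p0; rewrite (negbTE (noblk _ i')) (negbTE (noblk _ j')).
- by move: p0; rewrite (negbTE (noblk _ i')) (negbTE (noblk _ j')).
- by rewrite (increasing_ltn (shuffle_increasing2 s)) /= ltn_add2l.
Qed.

(** The conventions for empty blocks agree with a uniform description: the
superscript [p1] means that the first block reaches the top. *)
Lemma in_Sh_fst (p1 p2 : nat) (s : shuffle p1 p2) :
  (s \in Sh_fst p1 p2) = reaches_top (blk1 (val s)).
Proof.
case: p1 p2 s => [|p1] [|p2] s; rewrite ?inE.
- by apply/esym/reaches_topP => -[[]].
- by apply/esym/reaches_topP => -[[]].
- rewrite (shuffle_perm1 s) // eqxx; apply/esym/reaches_topP.
  by exists ord_max; rewrite /blk1 /= perm1 /= addn0.
apply/eqP/reaches_topP => [sE|/reaches_topP top].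
  by exists ord_max; rewrite /blk1 /= sE.
apply/val_inj/succn_inj/eqP.
by rewrite (increasing_top ord_max (shuffle_increasing1 s)).
Qed.

(** The superscript [p1 + p2] is the complementary condition, also when both
blocks are empty. *)
Lemma in_Sh_snd (p1 p2 : nat) (s : shuffle p1 p2) :
  (s \in Sh_snd p1 p2) = ~~ reaches_top (blk1 (val s)).
Proof.
case: p1 p2 s => [|p1] [|p2] s; rewrite ?inE.
- by rewrite (shuffle_perm1 s) // eqxx; apply/esym/reaches_topP => -[[]].
- by rewrite (shuffle_perm1 s) // eqxx; apply/esym/reaches_topP => -[[]].
- rewrite (shuffle_perm1 s) //; apply/esym/negbTE; rewrite negbK.
  by apply/reaches_topP; exists ord_max; rewrite /blk1 /= perm1 /= addn0.
transitivity (reaches_top (blk2 (val s))); last by rewrite blk2_reaches_top.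
apply/eqP/reaches_topP => [sE|/reaches_topP top].
  by exists ord_max; rewrite /blk2 /= sE.
apply/val_inj/succn_inj/eqP.
by rewrite (increasing_top ord_max (shuffle_increasing2 s)).
Qed.

(** * Shuffles of three blocks *)

Section Shuffle3.
Context (p q r : nat).

(** The restrictions of a permutation to its three blocks. *)
Definition blk3_1 (u : 'S_(p + q + r)) : 'I_p -> 'I_(p + q + r) :=
  u \o @lshift (p + q) r \o @lshift p q.
Definition blk3_2 (u : 'S_(p + q + r)) : 'I_q -> 'I_(p + q + r) :=
  u \o @lshift (p + q) r \o @rshift p q.
Definition blk3_3 (u : 'S_(p + q + r)) : 'I_r -> 'I_(p + q + r) :=
  u \o @rshift (p + q) r.

Definition is_shuffle3 (u : 'S_(p + q + r)) : bool :=
  [&& increasing (blk3_1 u), increasing (blk3_2 u) & increasing (blk3_3 u)].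

(** Permutations that are increasing on three consecutive blocks of sizes
[p], [q], [r]. *)
Definition shuffle3 : Type := {u : 'S_(p + q + r) | is_shuffle3 u}.

HB.instance Definition _ := SubFinite.on shuffle3.

(** Shuffle the first two blocks by [t], then shuffle the result with the third
block by [s]. *)
Definition joinl_perm (s : 'S_(p + q + r)) (t : 'S_(p + q)) : 'S_(p + q + r) :=
  (block_perm t 1 * s)%g.

Lemma joinl1 s t i : blk3_1 (joinl_perm s t) i = blk1 s (blk1 t i).
Proof. by rewrite /blk3_1 /= permM block_permL. Qed.

Lemma joinl2 s t i : blk3_2 (joinl_perm s t) i = blk1 s (blk2 t i).
Proof. by rewrite /blk3_2 /= permM block_permL. Qed.

Lemma joinl3 s t i : blk3_3 (joinl_perm s t) i = blk2 s i.
Proof. by rewrite /blk3_3 /= permM block_permR perm1. Qed.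

Lemma odd_joinl s t : odd_perm (joinl_perm s t) = odd_perm s (+) odd_perm t.
Proof. by rewrite odd_permM odd_block_perm odd_perm1 addbF addbC. Qed.

Lemma joinl_subproof (s : shuffle (p + q) r) (t : shuffle p q) :
  is_shuffle3 (joinl_perm (val s) (val t)).
Proof.
have /increasingP s1 := shuffle_increasing1 s.
have /increasingP s2 := shuffle_increasing2 s.
have /increasingP t1 := shuffle_increasing1 t.
have /increasingP t2 := shuffle_increasing2 t.
apply/and3P; split; apply/increasingP => i j ij.
- by rewrite !joinl1; apply/s1/t1.
- by rewrite !joinl2; apply/s1/t2.
- by rewrite !joinl3; apply/s2.
Qed.

Definition joinl (st : shuffle (p + q) r * shuffle p q) : shuffle3 :=
  exist (fun u => is_shuffle3 u) _ (joinl_subproof st.1 st.2).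

Lemma joinl_inj : injective joinl.
Proof.
move=> [s t] [s' t'] /(congr1 val) /= eq_j.
(* The outer shuffle is increasing on the merged block, so the inner one is
   determined by the relative order of the values on that block. *)
have tt' : t = t'.
  apply/val_inj/eq_perm_order => i j.
  have jE (s1 : shuffle (p + q) r) (t1 : shuffle p q) :
      forall i, joinl_perm (val s1) (val t1) (lshift r i)
        = blk1 (val s1) (val t1 i).
    by move=> h; rewrite permM block_permL.
  rewrite -(increasing_ltn (shuffle_increasing1 s)).
  rewrite -(increasing_ltn (shuffle_increasing1 s')).
  by rewrite -!jE eq_j.
congr (_, _) => //; apply/val_inj.
by move: eq_j; rewrite /joinl_perm tt' => /mulgI.
Qed.

Lemma joinl_surj (u : shuffle3) : exists st, joinl st = u.
Proof.
case: u => u u_sh; have /and3P[inc1 inc2 inc3] := u_sh.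
(* The inner shuffle is the standardization of [u] on the first two blocks. *)
have [t tE] := standardization
  (inj_comp (@perm_inj _ u) (@lshift_inj (p + q) r)).
pose s : 'S_(p + q + r) := ((block_perm t 1)^-1 * u)%g.
have uE : joinl_perm s t = u by rewrite /joinl_perm /s mulKVg.
have sE i : blk1 s (t i) = u (lshift r i).
  by rewrite -uE /joinl_perm permM block_permL.
have t_sh : is_shuffle t.
  apply/andP; split; apply/increasingP => i j ij; rewrite tE.
    exact: (increasingP _ inc1).
  exact: (increasingP _ inc2).
have s_sh : is_shuffle s.
  apply/andP; split; apply/increasingP => i j ij.
    have := tE (t^-1 i)%g (t^-1 j)%g; rewrite !permKV ij => /esym.
    by rewrite /= -!sE !permKV.
  have /increasingP := inc3; rewrite -{1}uE => /(_ _ _ ij).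
  by rewrite !joinl3.
exists (exist _ s s_sh, exist _ t t_sh); exact/val_inj.
Qed.

(** Shuffle the last two blocks by [t], then shuffle the first block with the
result by [s]; the cast reassociates the sum of the block sizes. *)
Definition joinr_perm (s : 'S_(p + (q + r))) (t : 'S_(q + r)) :
  'S_(p + q + r) := cast_perm (addnA p q r) (block_perm 1 t * s)%g.

Lemma joinr1 s t i :
  blk3_1 (joinr_perm s t) i = cast_ord (addnA p q r) (blk1 s i).
Proof.
rewrite /blk3_1 /= cast_permE permM.
have -> : cast_ord (esym (addnA p q r)) (lshift r (lshift q i)) =
  lshift (q + r) i by apply/val_inj.
by rewrite block_permL perm1.
Qed.

Lemma joinr2 s t i :
  blk3_2 (joinr_perm s t) i = cast_ord (addnA p q r) (blk2 s (blk1 t i)).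
Proof.
rewrite /blk3_2 /= cast_permE permM.
have -> : cast_ord (esym (addnA p q r)) (lshift r (rshift p i)) =
  rshift p (lshift r i) by apply/val_inj.
by rewrite block_permR.
Qed.

Lemma joinr3 s t i :
  blk3_3 (joinr_perm s t) i = cast_ord (addnA p q r) (blk2 s (blk2 t i)).
Proof.
rewrite /blk3_3 /= cast_permE permM.
have -> : cast_ord (esym (addnA p q r)) (rshift (p + q) i) =
  rshift p (rshift q i) by apply/val_inj; rewrite /= addnA.
by rewrite block_permR.
Qed.

Lemma odd_joinr s t : odd_perm (joinr_perm s t) = odd_perm s (+) odd_perm t.
Proof.
by rewrite odd_cast_perm odd_permM odd_block_perm odd_perm1 /= addbC.
Qed.

Lemma joinr_subproof (s : shuffle p (q + r)) (t : shuffle q r) :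
  is_shuffle3 (joinr_perm (val s) (val t)).
Proof.
have /increasingP s1 := shuffle_increasing1 s.
have /increasingP s2 := shuffle_increasing2 s.
have /increasingP t1 := shuffle_increasing1 t.
have /increasingP t2 := shuffle_increasing2 t.
apply/and3P; split; apply/increasingP => i j ij.
- by rewrite !joinr1; apply/s1.
- by rewrite !joinr2; apply/s2/t1.
- by rewrite !joinr3; apply/s2/t2.
Qed.

Definition joinr (st : shuffle p (q + r) * shuffle q r) : shuffle3 :=
  exist (fun u => is_shuffle3 u) _ (joinr_subproof st.1 st.2).

Lemma joinr_permE (s : 'S_(p + (q + r))) (t : 'S_(q + r)) (i : 'I_(q + r)) :
  joinr_perm s t (cast_ord (addnA p q r) (rshift p i)) =
  cast_ord (addnA p q r) (blk2 s (t i)).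
Proof. by rewrite cast_permE cast_ordK permM block_permR. Qed.

Lemma joinr_inj : injective joinr.
Proof.
move=> [s t] [s' t'] /(congr1 val) /= eq_j.
(* The outer shuffle is increasing on the merged block, so the inner one is
   determined by the relative order of the values on that block. *)
have tt' : t = t'.
  apply/val_inj/eq_perm_order => i j.
  have jE (s1 : shuffle p (q + r)) (t1 : shuffle q r) h :
      blk2 (val s1) (val t1 h) = joinr_perm (val s1) (val t1)
        (cast_ord (addnA p q r) (rshift p h)) :> nat.
    by rewrite joinr_permE.
  rewrite -(increasing_ltn (shuffle_increasing2 s)).
  rewrite -(increasing_ltn (shuffle_increasing2 s')).
  by rewrite !jE eq_j.
congr (_, _) => //; apply/val_inj.
by move: eq_j; rewrite /joinr_perm tt' => /cast_perm_inj/mulgI.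
Qed.

Lemma joinr_surj (u : shuffle3) : exists st, joinr st = u.
Proof.
case: u => u u_sh; have /and3P[inc1 inc2 inc3] := u_sh.
have injf : injective
    (fun i : 'I_(q + r) => u (cast_ord (addnA p q r) (rshift p i))).
  by move=> i j /perm_inj/cast_ord_inj/rshift_inj.
(* The inner shuffle is the standardization of [u] on the last two blocks. *)
have [t tE] := standardization injf.
pose s : 'S_(p + (q + r)) :=
  ((block_perm 1 t)^-1 * cast_perm (esym (addnA p q r)) u)%g.
have uE : joinr_perm s t = u.
  by rewrite /joinr_perm /s mulKVg cast_permKV.
have sE i : blk2 s (t i) = u (cast_ord (addnA p q r) (rshift p i)) :> nat.
  by rewrite -[in RHS]uE joinr_permE.
have castL i : cast_ord (addnA p q r) (rshift p (lshift r i)) =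
  lshift r (rshift p i) by apply/val_inj.
have castR i : cast_ord (addnA p q r) (rshift p (rshift q i)) =
  rshift (p + q) i by apply/val_inj; rewrite /= addnA.
have t_sh : is_shuffle t.
  apply/andP; split; apply/increasingP => i j ij; rewrite tE ?castL ?castR.
    exact: (increasingP _ inc2).
  exact: (increasingP _ inc3).
have s_sh : is_shuffle s.
  apply/andP; split; apply/increasingP => i j ij; last first.
    have := tE (t^-1 i)%g (t^-1 j)%g; rewrite !permKV ij => /esym.
    by rewrite -!sE !permKV.
  have /increasingP := inc1; rewrite -{1}uE => /(_ _ _ ij).
  by rewrite !joinr1.
exists (exist _ s s_sh, exist _ t t_sh); exact/val_inj.
Qed.

End Shuffle3.

(** * Cofaces of cubes *)

Lemma trunk_map_ext (T U : trunk) (F G : trunk_map T U) :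
  vmap F = vmap G -> emap F = emap G -> F = G.
Proof.
case: F G => v e s t p [v' e' s' t' p'] /= vv' ee'.
by case: _ / vv' ee' s' t' p' => ee'; case: _ / ee' => s' t' p';
  congr TrunkMap; apply: Prop_irrelevance.
Qed.

Lemma trunk_compA (T U V W : trunk) (H : trunk_map V W) (G : trunk_map U V)
    (F : trunk_map T U) :
  trunk_comp H (trunk_comp G F) = trunk_comp (trunk_comp H G) F.
Proof. exact: trunk_map_ext. Qed.

(** A trunk map into a cube is determined by its action on vertices and by the
directions of the images of the edges. *)
Lemma cube_map_ext (T : trunk) (n : nat) (F G : trunk_map T (cube n)) :
  (forall A, vmap F A = vmap G A) ->
  (forall e, edge_dir (emap F e : cube_edge n) =
             edge_dir (emap G e : cube_edge n)) ->
  F = G.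
Proof.
move=> vFG dFG; apply: trunk_map_ext; apply: funext => // e.
have /= := vFG (source e); rewrite -!(trunk_map_source) /=.
case: (emap F e) (emap G e) (dFG e) => A i iA [B j jB] /= dE sE.
case: _ / dE jB; case: _ / sE => jB.
by congr CubeEdge; apply: Prop_irrelevance.
Qed.

Section Coface.
Context (m n : nat) (f : 'I_m -> 'I_n) (B : {set 'I_n}).
Hypotheses (incf : increasing f) (fB : forall i, f i \notin B).

Lemma coface_add (A : {set 'I_m}) k :
  B :|: f @: (k |: A) = f k |: (B :|: f @: A).
Proof. by rewrite imsetU1 setUCA. Qed.

Lemma coface_notin (A : {set 'I_m}) k : k \notin A -> f k \notin B :|: f @: A.
Proof.
apply: contra; rewrite inE (negbTE (fB k)) => /imsetP[j jA].
by move/(increasing_inj incf)->.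
Qed.

(** The subcube of the [n]-cube with initial vertex [B] and directions
[f]. *)
Definition coface : trunk_map (cube m) (cube n) :=
  cube_map (v := fun A => B :|: f @: A) (elimT (increasingP f) incf)
    coface_add coface_notin.

End Coface.

Lemma cast_ord_increasing (m n : nat) (e : m = n) : increasing (cast_ord e).
Proof. exact/increasingP. Qed.

(** The identification of cubes of equal dimension. *)
Definition cube_cast (m n : nat) (e : m = n) : trunk_map (cube m) (cube n) :=
  coface (cast_ord_increasing e) (fun i => negbT (in_set0 (cast_ord e i))).

Lemma deg_castE (k : comPzRingType) (X : rack) (A : lmodType k) (m n : nat)
    (e : m = n) (f : cochain X A m) (F : nerve X n) :
  deg_cast (D := cochain X A) e f F = f (trunk_comp F (cube_cast e)).
Proof.
case: n / e F => F /=; congr f.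
transitivity (trunk_comp F (TrunkMap (T := cube m) (U := cube m) (vmap := id)
  (emap := id) (fun=> erefl) (fun=> erefl) (fun _ _ _ _ => id))).
  exact: trunk_map_ext.
congr trunk_comp; apply: cube_map_ext => [B|e] /=; last first.
  by rewrite cast_ord_id.
rewrite set0U; apply/esym/setP => i; apply/imsetP/idP => [[j jB ->]|iB].
  by rewrite cast_ord_id.
by exists i; rewrite ?cast_ord_id.
Qed.

Section Face3.
Context (p q r : nat) (u : shuffle3 p q r).

Let u1 := blk3_1 (val u).
Let u2 := blk3_2 (val u).
Let u3 := blk3_3 (val u).

Lemma shuffle3_increasing1 : increasing u1.
Proof. by case/and3P: (valP u). Qed.

Lemma shuffle3_increasing2 : increasing u2.
Proof. by case/and3P: (valP u). Qed.

Lemma shuffle3_increasing3 : increasing u3.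
Proof. by case/and3P: (valP u). Qed.

Lemma blk3_2_notin i : u2 i \notin [set u1 j | j : 'I_p].
Proof.
apply/imsetP => -[j _ /perm_inj/lshift_inj/eqP].
by rewrite eq_rlshift.
Qed.

Lemma blk3_3_notin i :
  u3 i \notin [set u1 j | j : 'I_p] :|: [set u2 j | j : 'I_q].
Proof.
by rewrite inE; apply/norP; split; apply/imsetP => -[j _ /perm_inj/eqP];
  rewrite eq_rlshift.
Qed.

(** The three consecutive subcubes along which a triple shuffle decomposes the
cube. *)
Definition face3_1 : trunk_map (cube p) (cube (p + q + r)) :=
  coface shuffle3_increasing1 (fun i => negbT (in_set0 (u1 i))).
Definition face3_2 : trunk_map (cube q) (cube (p + q + r)) :=
  coface shuffle3_increasing2 blk3_2_notin.
Definition face3_3 : trunk_map (cube r) (cube (p + q + r)) :=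
  coface shuffle3_increasing3 blk3_3_notin.

End Face3.

(** The image of a concatenation of two blocks. *)
Lemma imset_split (m1 m2 : nat) (T : finType) (f : 'I_(m1 + m2) -> T) :
  [set f i | i : 'I_(m1 + m2)] =
  [set f (lshift m2 i) | i : 'I_m1] :|: [set f (rshift m1 i) | i : 'I_m2].
Proof.
apply/setP => x; rewrite inE; apply/imsetP/orP => [[i _ ->]|].
  by case: (split_ordP i) => j ->; [left|right]; apply: imset_f.
by case=> /imsetP[i _ ->]; eexists.
Qed.

Lemma imset_perm (m : nat) (T : finType) (f : 'I_m -> T) (t : 'S_m) :
  [set f (t i) | i : 'I_m] = [set f i | i : 'I_m].
Proof.
apply/setP => x; apply/imsetP/imsetP => -[i _ ->]; first by exists (t i).
by exists (t^-1 i)%g; rewrite ?permKV.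
Qed.

Section FaceJoinl.
Context (p q r : nat) (s : shuffle (p + q) r) (t : shuffle p q).

(** The iterated faces for [(s, t)] are the three faces for [joinl (s, t)]. *)
Lemma face_joinl1 : trunk_comp (face1 s) (face1 t) = face3_1 (joinl (s, t)).
Proof.
apply: cube_map_ext => [B|e] /=; last by rewrite joinl1.
rewrite set0U /face1_vertex -imset_comp; apply: eq_imset => i /=.
by rewrite joinl1.
Qed.

Lemma face_joinl2 : trunk_comp (face1 s) (face2 t) = face3_2 (joinl (s, t)).
Proof.
apply: cube_map_ext => [B|e] /=; last by rewrite joinl2.
rewrite /face1_vertex /face2_vertex imsetU -!imset_comp.
by congr (_ :|: _); apply: eq_imset => i /=; rewrite ?joinl1 ?joinl2.
Qed.

Lemma face_joinl3 : face2 s = face3_3 (joinl (s, t)).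
Proof.
apply: cube_map_ext => [B|e] /=; last by rewrite joinl3.
(* The initial vertex is the whole image of the merged block, which the inner
   shuffle permutes. *)
rewrite /face2_vertex -(imset_perm (fun i => val s (lshift r i)) (val t)).
rewrite imset_split; congr (_ :|: _ :|: _);
  by apply: eq_imset => i /=; rewrite ?joinl1 ?joinl2 ?joinl3.
Qed.

End FaceJoinl.

Section FaceJoinr.
Context (p q r : nat) (s : shuffle p (q + r)) (t : shuffle q r).
Let c := cube_cast (addnA p q r).

(** The iterated faces for [(s, t)] are the three faces for [joinr (s, t)], up
to the identification of cubes of equal dimension. *)
Lemma face_joinr1 : trunk_comp c (face1 s) = face3_1 (joinr (s, t)).
Proof.
apply: cube_map_ext => [B|e] /=; last by rewrite joinr1.
rewrite !set0U /face1_vertex -imset_comp; apply: eq_imset => i /=.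
by rewrite joinr1.
Qed.

Lemma face_joinr2 :
  trunk_comp c (trunk_comp (face2 s) (face1 t)) = face3_2 (joinr (s, t)).
Proof.
apply: cube_map_ext => [B|e] /=; last by rewrite joinr2.
rewrite set0U /face2_vertex /face1_vertex imsetU -!imset_comp.
by congr (_ :|: _); apply: eq_imset => i /=; rewrite ?joinr1 ?joinr2.
Qed.

Lemma face_joinr3 :
  trunk_comp c (trunk_comp (face2 s) (face2 t)) = face3_3 (joinr (s, t)).
Proof.
apply: cube_map_ext => [B|e] /=; last by rewrite joinr3.
rewrite set0U /face2_vertex !imsetU -!imset_comp setUA.
by congr (_ :|: _ :|: _); apply: eq_imset => i /=;
  rewrite ?joinr1 ?joinr2 ?joinr3.
Qed.

End FaceJoinr.

(** * Products of cochains *)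

Lemma inj_surj_bij (S T : Type) (h : S -> T) :
  injective h -> (forall y, exists x, h x = y) -> bijective h.
Proof.
move=> hinj /choice[g hg].
by exists g => // x; apply: hinj; rewrite hg.
Qed.

Section Cochains.
Context (k : comPzRingType) (A : lmodType k) (mu : A -> A -> A).
Hypotheses (mu_bilinear : is_bilinear mu) (mu_assoc : associative mu).
Context (X : rack).

Lemma mu_sumr (x : A) (I : finType) (P : pred I) (c : I -> k) (v : I -> A) :
  mu x (\sum_(i | P i) c i *: v i) = \sum_(i | P i) c i *: mu x (v i).
Proof.
have lin := mu_bilinear.1 x.
have mu0 : mu x 0 = 0.
  by have := lin (-1) 0 0; rewrite scaler0 addr0 scaleN1r addNr.
apply: (big_ind2 (fun a b => mu x a = b)) => // [a _ b _ <- <-|i _].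
  by have := lin 1 a b; rewrite !scale1r.
by have := lin (c i) (v i) 0; rewrite mu0 !addr0.
Qed.

Lemma mu_suml (x : A) (I : finType) (P : pred I) (c : I -> k) (v : I -> A) :
  mu (\sum_(i | P i) c i *: v i) x = \sum_(i | P i) c i *: mu (v i) x.
Proof.
have lin := mu_bilinear.2 x.
have mu0 : mu 0 x = 0.
  by have := lin (-1) 0 0; rewrite scaler0 addr0 scaleN1r addNr.
apply: (big_ind2 (fun a b => mu a x = b)) => // [a _ b _ <- <-|i _].
  by have := lin 1 a b; rewrite !scale1r.
by have := lin (c i) (v i) 0; rewrite mu0 !addr0.
Qed.

(** The signed sum over the shuffles satisfying [P]. *)
Definition shuffle_prod (p q : nat) (P : pred (shuffle p q))
    (f : cochain X A p) (g : cochain X A q) : cochain X A (p + q) :=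
  fun F => \sum_(s | P s)
    (-1) ^+ odd_perm (val s) *: mu (f (rho s F).1) (g (rho s F).2).

(** The first block reaches the top. *)
Definition fst_top (p q : nat) : pred (shuffle p q) :=
  fun s => reaches_top (blk1 (val s)).

(** The first block does not reach the top: the second one does, or both blocks
are empty. *)
Definition snd_top (p q : nat) : pred (shuffle p q) := predC (@fst_top p q).

Lemma cochain_succE (p q : nat) (f : cochain X A p) (g : cochain X A q) :
  cochain_succ mu f g = shuffle_prod (@snd_top p q) f g.
Proof.
apply/funext => F; rewrite /cochain_succ fct_sumE; apply: eq_bigl => s.
exact: in_Sh_snd.
Qed.

Lemma cochain_precE (p q : nat) (f : cochain X A p) (g : cochain X A q) :
  cochain_prec mu f g = shuffle_prod (@fst_top p q) f g.
Proof.
apply/funext => F; rewrite /cochain_prec fct_sumE; apply: eq_bigl => s.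
exact: in_Sh_fst.
Qed.

Lemma shuffle_prod_bilinear (p q : nat) (P : pred (shuffle p q)) :
  is_bilinear (shuffle_prod P).
Proof.
split=> [f a g g'|g a f f']; apply/funext => F.
  apply: (@etrans _ _
    (a *: shuffle_prod P f g F + shuffle_prod P f g' F)) => //.
  rewrite /shuffle_prod scaler_sumr -big_split; apply: eq_bigr => s _ /=.
  by rewrite (mu_bilinear.1 _) scalerDr !scalerA mulrC.
apply: (@etrans _ _ (a *: shuffle_prod P f g F + shuffle_prod P f' g F)) => //.
rewrite /shuffle_prod scaler_sumr -big_split; apply: eq_bigr => s _ /=.
by rewrite (mu_bilinear.2 _) scalerDr !scalerA mulrC.
Qed.

Lemma shuffle_prodC (p q : nat) (P : pred (shuffle p q))
    (f : cochain X A p) (g : cochain X A q) :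
  shuffle_prod P f g + shuffle_prod (predC P) f g = shuffle_prod xpredT f g.
Proof. by apply/funext => F; rewrite /shuffle_prod [RHS](bigID P). Qed.

(** The signed sum over the triple shuffles satisfying [R]. *)
Definition shuffle_prod3 (p q r : nat) (R : pred (shuffle3 p q r))
    (f : cochain X A p) (g : cochain X A q) (h : cochain X A r) :
    cochain X A (p + q + r) :=
  fun F => \sum_(u | R u) (-1) ^+ odd_perm (val u) *:
    mu (mu (f (trunk_comp F (face3_1 u))) (g (trunk_comp F (face3_2 u))))
      (h (trunk_comp F (face3_3 u))).

(** A left-bracketed product of three cochains is a sum over triple shuffles,
by reindexing along [joinl]. *)
Lemma shuffle_prodl (p q r : nat) (P : pred (shuffle (p + q) r))
    (Q : pred (shuffle p q)) (R : pred (shuffle3 p q r))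
    (f : cochain X A p) (g : cochain X A q) (h : cochain X A r) :
  (forall s t, R (joinl (s, t)) = P s && Q t) ->
  shuffle_prod P (shuffle_prod Q f g) h = shuffle_prod3 R f g h.
Proof.
move=> RE; apply/funext => F; rewrite /shuffle_prod3.
rewrite (reindex (@joinl p q r)) /=; last first.
  exact/onW_bij/inj_surj_bij/joinl_surj/joinl_inj.
rewrite /shuffle_prod /=.
under eq_bigr => s _ do rewrite mu_suml scaler_sumr.
rewrite pair_big; apply: eq_big => [[s t]|[s t] _] //=.
rewrite scalerA -signr_addb -odd_joinl; congr (_ *: mu (mu (f _) (g _)) (h _)).
- by rewrite -face_joinl1 trunk_compA.
- by rewrite -face_joinl2 trunk_compA.
- by rewrite -face_joinl3.
Qed.

(** A right-bracketed product of three cochains is a sum over triple shuffles,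
by reindexing along [joinr]. *)
Lemma shuffle_prodr (p q r : nat) (P : pred (shuffle p (q + r)))
    (Q : pred (shuffle q r)) (R : pred (shuffle3 p q r))
    (f : cochain X A p) (g : cochain X A q) (h : cochain X A r) :
  (forall s t, R (joinr (s, t)) = P s && Q t) ->
  deg_cast (D := cochain X A) (addnA p q r)
    (shuffle_prod P f (shuffle_prod Q g h)) = shuffle_prod3 R f g h.
Proof.
move=> RE; apply/funext => F; rewrite deg_castE /shuffle_prod3.
rewrite (reindex (@joinr p q r)) /=; last first.
  exact/onW_bij/inj_surj_bij/joinr_surj/joinr_inj.
rewrite /shuffle_prod /=.
under eq_bigr => s _ do rewrite mu_sumr scaler_sumr.
rewrite pair_big; apply: eq_big => [[s t]|[s t] _] //=.
rewrite scalerA -signr_addb -odd_joinr mu_assoc.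
congr (_ *: mu (mu (f _) (g _)) (h _)).
- by rewrite -(face_joinr1 s t) trunk_compA.
- by rewrite -face_joinr2 !trunk_compA.
- by rewrite -face_joinr3 !trunk_compA.
Qed.

End Cochains.

(** * The block of a triple shuffle that reaches the top *)

Section Top3.
Context (p q r : nat).

(** The first, respectively second, block reaches the top. *)
Definition top1 : pred (shuffle3 p q r) :=
  fun u => reaches_top (blk3_1 (val u)).
Definition top2 : pred (shuffle3 p q r) :=
  fun u => reaches_top (blk3_2 (val u)).
(** The third block reaches the top; stated as a complement, so as to include
the case of three empty blocks. *)
Definition top3 : pred (shuffle3 p q r) := fun u => ~~ (top1 u || top2 u).

Section Joinl.
Context (s : shuffle (p + q) r) (t : shuffle p q).
Let sinc := shuffle_increasing1 s.

Lemma joinl_fst_top : fst_top s = top1 (joinl (s, t)) || top2 (joinl (s, t)).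
Proof.
rewrite /fst_top -(reaches_top_perm _ (val t)) reaches_top_split.
by congr (_ || _); apply: eq_reaches_top => // i /=; rewrite ?joinl1 ?joinl2.
Qed.

Lemma joinl_top1 : top1 (joinl (s, t)) = fst_top s && fst_top t.
Proof.
have -> : top1 (joinl (s, t)) = reaches_top (blk1 (val s) \o blk1 (val t)).
  by apply: eq_reaches_top => // i; rewrite joinl1.
apply/idP/andP => [top|[tops topt]]; last by rewrite reaches_top_comp.
have tops := reaches_top_compW top.
by split=> //; rewrite /fst_top -(reaches_top_comp _ sinc tops).
Qed.

Lemma joinl_top2 : top2 (joinl (s, t)) = fst_top s && snd_top t.
Proof.
have disj : top1 (joinl (s, t)) -> top2 (joinl (s, t)) = false.
  apply: (reaches_top_disjoint
    (f := val (joinl (s, t)) \o @lshift (p + q) r)).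
  exact: inj_comp perm_inj (@lshift_inj _ _).
rewrite /snd_top /=; case: (boolP (fst_top t)) => [topt|/negbTE topt].
  have := joinl_top1; rewrite topt andbT andbF => top1E.
  apply/negbTE/negP => top2t.
  have : fst_top s by rewrite joinl_fst_top top2t orbT.
  by rewrite -top1E => /disj top2f; rewrite top2f in top2t.
by rewrite andbT joinl_fst_top joinl_top1 topt andbF.
Qed.

Lemma joinl_top3 : top3 (joinl (s, t)) = snd_top s.
Proof. by rewrite /top3 -joinl_fst_top. Qed.

End Joinl.

Section Joinr.
Context (s : shuffle p (q + r)) (t : shuffle q r).
Let sinc := shuffle_increasing2 s.

Lemma joinr_top1 : top1 (joinr (s, t)) = fst_top s.
Proof.
by apply: eq_reaches_top => [|i]; rewrite ?addnA // joinr1.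
Qed.

Lemma joinr_top2 : top2 (joinr (s, t)) = snd_top s && fst_top t.
Proof.
have -> : top2 (joinr (s, t)) = reaches_top (blk2 (val s) \o blk1 (val t)).
  by apply: eq_reaches_top => [|i]; rewrite ?addnA // joinr2.
apply/idP/andP => [top|[tops topt]].
  have tops := reaches_top_compW top; split.
    by have := blk2_reaches_top (val s); rewrite tops => /esym/andP[].
  by rewrite /fst_top -(reaches_top_comp _ sinc tops).
rewrite reaches_top_comp // blk2_reaches_top; apply/andP; split=> //.
by case/reaches_topP: topt => i qrE; rewrite -qrE addnS.
Qed.

Lemma joinr_top3 : top3 (joinr (s, t)) = snd_top s && snd_top t.
Proof.
rewrite /top3 joinr_top1 joinr_top2 /snd_top /=.
by case: (fst_top s); case: (fst_top t).
Qed.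

End Joinr.

End Top3.

(** * The dendriform identities *)

Theorem theorem4p2 (k : comPzRingType) (A : lmodType k) (mu : A -> A -> A)
    (mu_bilinear : is_bilinear mu) (mu_assoc : associative mu) (X : rack) :
  is_graded_dendriform (D := cochain X A)
    (fun p q => @cochain_succ k X A mu p q)
    (fun p q => @cochain_prec k X A mu p q).
Proof.
have succE p q : @cochain_succ k X A mu p q = shuffle_prod mu (@snd_top p q).
  by apply/funext => f; apply/funext => g; apply: cochain_succE.
have precE p q : @cochain_prec k X A mu p q = shuffle_prod mu (@fst_top p q).
  by apply/funext => f; apply/funext => g; apply: cochain_precE.
have bil p q (P : pred (shuffle p q)) :
    is_bilinear (shuffle_prod mu P (X := X)).
  exact: shuffle_prod_bilinear.
have addl p q (P : pred (shuffle p q)) f f' g :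
    shuffle_prod mu P f g + shuffle_prod mu P f' g =
    shuffle_prod mu P (f + f') g :> cochain X A _.
  by have := (bil p q P).2 g 1 f f'; rewrite !scale1r => ->.
have addr p q (P : pred (shuffle p q)) f g g' :
    shuffle_prod mu P f g + shuffle_prod mu P f g' =
    shuffle_prod mu P f (g + g') :> cochain X A _.
  by have := (bil p q P).1 f 1 g g'; rewrite !scale1r => ->.
split=> [p q|p q|p q r f g h|p q r f g h|p q r f g h].
- by rewrite succE.
- by rewrite precE.
(* The two right-hand terms merge into a sum over all inner shuffles. *)
- rewrite !succE precE addl addrC shuffle_prodC.
  rewrite (shuffle_prodr mu_bilinear mu_assoc _ _ _ (@joinr_top3 p q r)).
  rewrite (shuffle_prodl mu_bilinear (R := @top3 p q r)) // => s t.
  by rewrite joinl_top3 andbT.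
- rewrite !succE !precE (shuffle_prodl mu_bilinear _ _ _ (@joinl_top2 p q r)).
  by rewrite (shuffle_prodr mu_bilinear mu_assoc _ _ _ (@joinr_top2 p q r)).
(* The two right-hand terms merge into a sum over all inner shuffles. *)
- rewrite succE !precE addr shuffle_prodC.
  rewrite (shuffle_prodl mu_bilinear _ _ _ (@joinl_top1 p q r)).
  rewrite (shuffle_prodr mu_bilinear mu_assoc (R := @top1 p q r)) // => s t.
  by rewrite joinr_top1 andbT.
Qed.
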